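(* Let $d\ge 1$ and $0\le k\le d+1$. Then $[x^\ell]Q_{d,k}(x)=[x^{d+1-\ell}]Q_{d,d+1-k}(x)$ for all $0\le\ell\le d+1$.
   Context: For $j\ge 0$ let $g(L_j,x)=\sum_{m=0}^{\lfloor j/2\rfloor}\frac{1}{j-m+1}\binom{j}{m}\binom{2j-2m}{j}(x-1)^m$. Define $Q_{d,0}(x)=(x-1)^{d+1}+\sum_{j=0}^{d}2^{d-j}\binom{d}{j}(x-1)^{d-j}g(L_j,x)$; for $1\le k\le d$, $Q_{d,k}(x)=\sum_{j=k-1}^{d}2^{d-j}\left[\binom{d-k}{d-j}+\binom{d+1-k}{d-j}\right](x-1)^{d-j}g(L_j,x)$; and $Q_{d,d+1}(x)=g(L_d,x)$. $[x^\ell]p(x)$ denotes the coefficient of $x^\ell$ in $p(x)$. *)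

(* Defs.v *)
From mathcomp Require Import all_boot all_order all_algebra.

Set Implicit Arguments.
Unset Strict Implicit.
Unset Printing Implicit Defensive.

Import GRing.Theory.
Local Open Scope ring_scope.

Definition gL (j : nat) : {poly rat} :=
  \sum_(0 <= m < (j./2).+1)
    ((j - m + 1)%:R^-1 * 'C(j, m)%:R * 'C(2 * j - 2 * m, j)%:R)
      *: ('X - 1) ^+ m.

(* All natural-number subtractions are exact on the ranges where they are used,
   and the last branch is meant for k = d + 1 only. *)
Definition Q (d k : nat) : {poly rat} :=
  if k == 0%N then
    ('X - 1) ^+ (d + 1) +
    \sum_(0 <= j < d.+1)
      (2 ^+ (d - j) * 'C(d, j)%:R) *: (('X - 1) ^+ (d - j) * gL j)
  else if (k <= d)%N then
    \sum_(k - 1 <= j < d.+1)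
      (2 ^+ (d - j) * ('C(d - k, d - j)%:R + 'C(d + 1 - k, d - j)%:R))
        *: (('X - 1) ^+ (d - j) * gL j)
  else gL d.

(* Main.v *)
(* With y = x - 1 and c = 1 + z c^2 the Catalan series, the g(L_j, x) are the
   coefficients of G(t) = c(t + y t^2), and their reversals x^j g(L_j, 1/x) are
   those of G'(t) = c(x t - x y t^2). Both x G'(t) and
   y / (1 - y t) + G(t / (1 - 2 y t)) / (1 - 2 y t) solve the quadratic equation
   K = x + t (1 - y t) K^2, whose power series solution is unique. Hence
   x g'_n = y^(n+1) + sum_j C(n, j) (2 y)^(n-j) g_j, which is the case k = d + 1;
   the other cases follow by inverting the binomial transform. Power series are
   represented by polynomials modulo 'X^N, in the shape p = q + 'X^N * r. *)
Require Import Defs.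
From mathcomp Require Import all_boot all_order all_algebra.
From mathcomp Require Import ring zify.

Import GRing.Theory.
Local Open Scope ring_scope.

(** * Catalan numbers and their convolution *)

Definition catalan (n : nat) : nat := ('C(2 * n, n) - 'C(2 * n, n.+1))%N.

Lemma mul_catalan (n : nat) : (n.+1 * catalan n = 'C(2 * n, n))%N.
Proof.
have E : (n.+1 * 'C(2 * n, n.+1) = n * 'C(2 * n, n))%N.
  by rewrite mul_bin_left; congr (_ * _)%N; lia.
by rewrite mulnBr E mulSn addnK.
Qed.

Lemma catalanS (n : nat) : (n.+2 * catalan n.+1 = (4 * n + 2) * catalan n)%N.
Proof.
have E : (n.+1 * 'C(2 * n.+1, n.+1) = 2 * (2 * n + 1) * 'C(2 * n, n))%N.
  have e1 := mul_bin_diag (2 * n).+1 n.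
  have e2 := mul_bin_down (2 * n).+1 n.
  have -> : (2 * n.+1 = (2 * n).+2)%N by lia.
  have e3 : ((2 * n).+1 - n = n.+1)%N by lia.
  by rewrite e3 /= in e1 e2; rewrite binS mulnDr -e1 -e2; lia.
apply/eqP; rewrite -(@eqn_pmul2l n.+1) //; apply/eqP.
rewrite mul_catalan E -mul_catalan; lia.
Qed.

(* Pairing [i] with [n - i] evaluates the sum weighted by [i], and
   [catalanS] then turns it into a recurrence for the plain convolution. *)
Lemma catalan_conv (n : nat) :
  catalan n.+1 = (\sum_(i < n.+1) catalan i * catalan (n - i))%N.
Proof.
pose S n := (\sum_(i < n.+1) catalan i * catalan (n - i))%N.
pose T n := (\sum_(i < n.+1) i * (catalan i * catalan (n - i)))%N.
have ST m : (2 * T m = m * S m)%N.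
  rewrite mul2n -addnn {2}/T (reindex_inj rev_ord_inj) /= /T -big_split /=.
  rewrite /S big_distrr; apply: eq_bigr => i _ /=.
  have lei : (i <= m)%N by rewrite -ltnS.
  rewrite subSS subKn // [X in (_ + _ * X)%N]mulnC -mulnDl subnKC //.
(* Past the term [i = 0], the shifted weight is [i + 2], which [catalanS] turns into [4 i + 2]. *)
have rec m : (T m.+1 + S m.+1 = catalan m.+1 + 4 * T m + 2 * S m)%N.
  rewrite /T /S -big_split /= big_ord_recl /= subn0 mul0n add0n mul1n -addnA.
  congr addn; rewrite !big_distrr -big_split /=; apply: eq_bigr => i _ /=.
  rewrite /bump /= add1n subSS; have := catalanS i; nia.
suff : catalan n.+1 = S n by [].
elim: n => [|n IHn]; first by rewrite /S big_ord1.
have := ST n; have := ST n.+1; have := rec n; have := catalanS n.+1.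
rewrite -IHn; nia.
Qed.

Lemma sum_ord_widen (V : nmodType) (f : nat -> V) (k m : nat) : (k <= m)%N ->
  (forall i, (k <= i)%N -> f i = 0) -> \sum_(i < k) f i = \sum_(i < m) f i.
Proof.
move=> lekm f0; rewrite (big_ord_widen _ _ lekm) big_mkcond.
by apply: eq_bigr => i _; case: ltnP => // /f0.
Qed.

(** * Power series modulo ['X^N] and the quadratic equation *)

Section TruncatedSeries.

Variable R : comNzRingType.
Implicit Types (p q r : {poly R}) (a b x y : R).

Lemma eq_coef_modXn (N : nat) p q :
  (forall i, (i < N)%N -> p`_i = q`_i) -> exists r, p = q + 'X^N * r.
Proof.
move=> e; exists (drop_poly N p - drop_poly N q).
rewrite -{1}(poly_take_drop N p) -{1}(poly_take_drop N q).
have -> : take_poly N p = take_poly N q.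
  by apply/polyP => i; rewrite !coef_take_poly; case: ifP => // /e.
ring.
Qed.

Lemma coef_addXnM (N i : nat) p r : (i < N)%N -> (p + 'X^N * r)`_i = p`_i.
Proof. by move=> ltiN; rewrite coefD coefXnM ltiN addr0. Qed.

(** Subtracting the equations gives [p - q = 'X b (p - q)(p + q)] modulo ['X^N], so each use gains
    one factor ['X] in the agreement. *)
Lemma quadratic_modXn_uniq (N : nat) (p q c b d e : {poly R}) :
  p = c + 'X * b * p ^+ 2 + 'X^N * d -> q = c + 'X * b * q ^+ 2 + 'X^N * e ->
  exists r, p = q + 'X^N * r.
Proof.
move=> Ep Eq; suff: forall i, (i <= N)%N -> exists r, p = q + 'X^i * r by apply.
elim=> [_|i IHi ltiN]; first by exists (p - q); ring.
have [r Er] := IHi (ltnW ltiN).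
exists (b * r * (p + q) + 'X^(N - i.+1) * (d - e)).
have EN : 'X^N = 'X * 'X^i * 'X^(N - i.+1) :> {poly R}.
  by rewrite -exprS -exprD subnKC.
rewrite exprS {1}Ep {1}Eq EN.
have -> : p ^+ 2 = q ^+ 2 + 'X^i * r * (p + q) by rewrite Er; ring.
ring.
Qed.

Definition catalan_poly (N : nat) : {poly R} := \poly_(n < N) (catalan n)%:R.

Lemma catalan_polyE (N : nat) : exists e,
  catalan_poly N = 1 + 'X * catalan_poly N ^+ 2 + 'X^N * e.
Proof.
apply: eq_coef_modXn => -[|n] ltnN.
  by rewrite coef_poly ltnN coefD coef1 coefXM addr0.
rewrite coef_poly ltnN coefD coef1 coefXM /= add0r expr2 coefM catalan_conv.
rewrite natr_sum; apply: eq_bigr => i _; rewrite natrM !coef_poly.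
have ltiN : (i < N)%N by apply: leq_trans (ltn_ord i) (ltnW ltnN).
by rewrite ltiN (leq_ltn_trans (leq_subr _ _) (ltnW ltnN)).
Qed.

(** This agrees with [c (a t + b t^2)] below degree [N]: [(a, b) = (1, y)] gives G and [(x, - x y)]
    gives G'. *)
Definition catalan_sub (N : nat) (a b : R) : {poly R} :=
  catalan_poly N \Po ('X * (a%:P + b%:P * 'X)).

Lemma catalan_subE (N : nat) a b : exists e,
  catalan_sub N a b = 1 + 'X * (a%:P + b%:P * 'X) * catalan_sub N a b ^+ 2
                      + 'X^N * e.
Proof.
have [e Ee] := catalan_polyE N.
pose z : {poly R} := 'X * (a%:P + b%:P * 'X).
exists ((a%:P + b%:P * 'X) ^+ N * (e \Po z)).
rewrite {1}/catalan_sub Ee !comp_polyD !comp_polyM !comp_Xn_poly comp_polyX.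
rewrite comp_polyC exprMn -/z /catalan_sub -/z; ring.
Qed.

(* The coefficient of [t^j] in [c (a t + b t^2)], [c] the Catalan series; the
   terms with [j < 2 m] vanish. *)
Definition gcoef (a b : R) (j : nat) : R :=
  \sum_(m < j.+1)
    (catalan (j - m) * 'C(j - m, m))%:R * (a ^+ (j - m - m) * b ^+ m).

Lemma coef_linear_exp a b (n m : nat) :
  ((a%:P + b%:P * 'X) ^+ n)`_m = 'C(n, m)%:R * (a ^+ (n - m) * b ^+ m).
Proof.
rewrite exprDn coef_sum.
have coefE (i : nat) : ((a%:P ^+ (n - i) * (b%:P * 'X) ^+ i) *+ 'C(n, i))`_m =
    if i == m then 'C(n, m)%:R * (a ^+ (n - m) * b ^+ m) else 0.
  rewrite exprMn -!polyC_exp coefMn !coefCM coefXn eq_sym.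
  by case: eqP => [->|_]; rewrite ?mulr1 ?mulr_natl ?mulr0 ?mul0rn.
under eq_bigr do rewrite coefE.
rewrite -big_mkcond /=; case: (ltnP m n.+1) => [ltmn|ltnm].
  by rewrite (big_pred1 (Ordinal ltmn)).
rewrite bin_small // mul0r big_pred0 // => i.
by apply/eqP => e; have := ltn_ord i; rewrite e ltnNge ltnm.
Qed.

Lemma coef_catalan_sub (N j : nat) a b : (j < N)%N ->
  (catalan_sub N a b)`_j = gcoef a b j.
Proof.
move=> ltjN; have -> : catalan_sub N a b =
    \sum_(n < N) (catalan n)%:R *: ('X^n * (a%:P + b%:P * 'X) ^+ n).
  rewrite /catalan_sub /catalan_poly poly_def raddf_sum; apply: eq_bigr => i _.
  by rewrite /= comp_polyZ comp_Xn_poly exprMn.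
(* Terms with [n > j] are divisible by ['X^(j+1)]; the others are reindexed by [n = j - m]. *)
rewrite coef_sum (bigID (fun n : 'I_N => (n < j.+1)%N)) /= addrC big1 => [|n].
  rewrite add0r -(big_ord_widen _ (fun n => ((catalan n)%:R *:
    ('X^n * (a%:P + b%:P * 'X) ^+ n))`_j)) // (reindex_inj rev_ord_inj) /=.
  apply: eq_bigr => m _; have lemj : (m <= j)%N by rewrite -ltnS.
  rewrite coefZ coefXnM subSS ltnNge leq_subr /= subKn // coef_linear_exp.
  by rewrite natrM -[RHS]mulrA.
by rewrite -leqNgt coefZ coefXnM => ->; rewrite mulr0.
Qed.

(** * Geometric series and the binomial transform *)

Definition geom_poly (N : nat) (a : R) : {poly R} := \poly_(i < N) a ^+ i.

Lemma geom_polyE (N : nat) a : exists e,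
  geom_poly N a = 1 + a%:P * 'X * geom_poly N a + 'X^N * e.
Proof.
apply: eq_coef_modXn => -[|n] ltnN.
  by rewrite coef_poly ltnN coefD coef1 -mulrA coefCM coefXM mulr0 addr0.
rewrite coef_poly ltnN coefD coef1 -mulrA coefCM coefXM /= add0r coef_poly.
by rewrite (ltnW ltnN) exprS.
Qed.

(** Multiplying B = 1 + a t B by a power of B gives a recurrence on coefficients that is Pascal's
    rule. *)
Lemma coef_geom_poly_exp (N j n : nat) a : (n < N)%N ->
  (geom_poly N a ^+ j.+1)`_n = 'C(n + j, j)%:R * a ^+ n.
Proof.
have [e Ee] := geom_polyE N a.
elim: j n => [|j IHj] n; first by move=> ltnN; rewrite coef_poly ltnN bin0 mul1r.
have E : geom_poly N a ^+ j.+2 = geom_poly N a ^+ j.+1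
    + a%:P * ('X * geom_poly N a ^+ j.+2) + 'X^N * (e * geom_poly N a ^+ j.+1).
  by rewrite exprS [X in X * _ = _]Ee; ring.
elim: n => [|n IHn] ltnN; rewrite E coef_addXnM // coefD IHj // coefCM coefXM.
  by rewrite !add0n !binn /= mulr0 addr0.
rewrite /= IHn ?(ltnW ltnN) // -(addSnnS n j) addnS binS natrD exprS.
ring.
Qed.

Definition binomial_transform (z : R) (g : nat -> R) (n : nat) : R :=
  \sum_(j < n.+1) 'C(n, j)%:R * z ^+ (n - j) * g j.

(** With B = 1 / (1 - a t), the term of index [j] is [p_j t^j B^(j+1)], whose coefficients are known
    from [coef_geom_poly_exp]. *)
Lemma coef_binomial_transform (N n : nat) a p : (n < N)%N ->
  (geom_poly N a * (p \Po ('X * geom_poly N a)))`_n =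
  binomial_transform a (nth 0 p) n.
Proof.
move=> ltnN; pose f j := 'C(n, j)%:R * a ^+ (n - j) * p`_j.
rewrite comp_polyE mulr_sumr coef_sum /binomial_transform.
transitivity (\sum_(j < size p) f j).
  apply: eq_bigr => j _.
  rewrite -scalerAr exprMn mulrCA -exprS coefZ coefXnM /f mulrC.
  case: ltnP => [ltnj|lejn]; first by rewrite bin_small // !mul0r.
  by rewrite coef_geom_poly_exp ?subnK // (leq_ltn_trans (leq_subr _ _)).
rewrite (sum_ord_widen _ f _ (maxn (size p) n.+1)) ?leq_maxl //; last first.
  by move=> i lei; rewrite /f nth_default ?mulr0.
rewrite [RHS](sum_ord_widen _ f _ (maxn (size p) n.+1)) ?leq_maxr // => i lei.
by rewrite /f bin_small // !mul0r.
Qed.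

(* Substituting [t / (1 - 2 y t)] for [t] in [F = 1 + t (1 + y t) F^2] and
   multiplying by [1 / (1 - 2 y t)] yields [H = 1 + 2 y t H + t (1 - y t) H^2];
   adding [y / (1 - y t)] absorbs the linear term. *)
Lemma quadratic_binomial_transform (N : nat) y p e :
  p = 1 + 'X * (1%:P + y%:P * 'X) * p ^+ 2 + 'X^N * e ->
  let q := y%:P * geom_poly N y
    + geom_poly N (2 * y) * (p \Po ('X * geom_poly N (2 * y))) in
  exists r, q = (1 + y%:P) + 'X * (1 - y%:P * 'X) * q ^+ 2 + 'X^N * r.
Proof.
set b := geom_poly N (2 * y); set s := 'X * b => Ep.
have [c Ec] := geom_polyE N (2 * y); rewrite -/b in Ec.
have [c' Ec'] := geom_polyE N y; set g := geom_poly N y in Ec' *.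
set f := p \Po s; pose h := b * f.
have Ef : f = 1 + 'X * b * (1 + y%:P * ('X * b)) * f ^+ 2
              + 'X^N * (b ^+ N * (e \Po s)).
  rewrite {1}/f Ep !comp_polyD !comp_polyM !comp_polyD comp_polyM comp_Xn_poly.
  by rewrite comp_polyX !comp_polyC -/f /s exprMn; ring.
rewrite polyCM polyC_natr in Ec.
pose e1 := c * f - 'X * h * c * f + b ^+ N * (e \Po s).
have Eh : h = 1 + 2 * y%:P * 'X * h + 'X * (1 - y%:P * 'X) * h ^+ 2
              + 'X^N * e1.
  apply/eqP; rewrite -subr_eq0; apply/eqP.
  (* The difference of the two sides is a combination of the defects of the equations for [b] and
     [f], both zero; [e1] collects its multiples of ['X^N], up to sign. *)
  transitivity ((b - (1 + 2 * y%:P * 'X * b + 'X^N * c)) * (f - 'X * h * f)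
    + (f - (1 + 'X * b * (1 + y%:P * ('X * b)) * f ^+ 2
              + 'X^N * (b ^+ N * (e \Po s))))); last first.
    by rewrite -Ec -Ef !subrr mul0r addr0.
  rewrite /e1 /h; ring.
rewrite -/h /=.
exists (y%:P * c' - 'X * y%:P ^+ 2 * g * c' - 2 * 'X * y%:P * c' * h + e1).
apply/eqP; rewrite -subr_eq0; apply/eqP.
transitivity ((g - (1 + y%:P * 'X * g + 'X^N * c'))
    * (y%:P - 'X * y%:P ^+ 2 * g - 2 * 'X * y%:P * h)
  + (h - (1 + 2 * y%:P * 'X * h + 'X * (1 - y%:P * 'X) * h ^+ 2
              + 'X^N * e1))); last by rewrite -Ec' -Eh !subrr mul0r addr0.
ring.
Qed.

Lemma gcoef_duality x y (n : nat) : x = 1 + y ->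
  x * gcoef x (- (x * y)) n = binomial_transform (2 * y) (gcoef 1 y) n + y ^+ n.+1.
Proof.
move=> Ex; have [e Ee] := catalan_subE n.+1 1 y.
have [r Er] := quadratic_binomial_transform _ _ _ _ Ee.
have [e' Ee'] := catalan_subE n.+1 x (- (x * y)).
(* Since [x - x y t = x (1 - y t)], multiplying the equation of G' by [x] gives the equation for
   K. *)
have EK : x%:P * catalan_sub n.+1 x (- (x * y)) = (1 + y%:P)
   + 'X * (1 - y%:P * 'X) * (x%:P * catalan_sub n.+1 x (- (x * y))) ^+ 2
   + 'X^(n.+1) * (x%:P * e').
  have Ex' : x%:P = 1 + y%:P :> {poly R} by rewrite Ex polyCD.
  by rewrite [in LHS]Ee' polyCN polyCM -Ex'; ring.
have [u Eu] := quadratic_modXn_uniq _ _ _ _ _ _ _ EK Er.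
move/(congr1 (fun p : {poly R} => p`_n)): Eu.
rewrite coef_addXnM // coefCM coef_catalan_sub // => ->.
rewrite coefD coefCM coef_poly ltnSn -exprS addrC coef_binomial_transform //.
congr (_ + _); apply: eq_bigr => i _; congr (_ * _).
by rewrite coef_catalan_sub.
Qed.

(** * Inversion of the binomial transform *)

(** For [m <= d] this is the umbral value of ['X^(d - m) * ('X + z)^m]. The range depends on [d]
    only, so sums with different [m] combine termwise. *)
Definition binomial_sum (d : nat) (z : R) (g : nat -> R) (m : nat) : R :=
  \sum_(i < d.+1) 'C(m, i)%:R * z ^+ i * g (d - i)%N.

(* Umbral calculus: for the linear form [L] sending ['X^j] to [g j], both sides
   are [L ('X^m * ('X + z)^(d - m))]. *)
Lemma binomial_sum_transform (d m : nat) z (g : nat -> R) : (m <= d)%N ->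
  binomial_sum d (- z) (binomial_transform z g) m = binomial_sum d z g (d - m).
Proof.
move=> lemd; pose L (p : {poly R}) := \sum_(j < d.+1) p`_j * g j.
have LD : {morph L : p q / p + q}.
  by move=> p q; rewrite /L -big_split; apply: eq_bigr => j _; rewrite coefD mulrDl.
have L0 : L 0 = 0 by rewrite /L big1 // => j _; rewrite coef0 mul0r.
have LC a p : L (a%:P * p) = a * L p.
  by rewrite /L mulr_sumr; apply: eq_bigr => j _; rewrite coefCM mulrA.
have LX n : (n <= d)%N -> L 'X^n = g n.
  rewrite -ltnS => ltnd; rewrite /L (bigD1 (Ordinal ltnd)) //= coefXn eqxx mul1r.
  rewrite big1 ?addr0 // => j; rewrite -val_eqE /= => /negPf nj.
  by rewrite coefXn nj mul0r.
have Lexp n : (n <= d)%N -> L ((z%:P + 1%:P * 'X) ^+ n) = binomial_transform z g n.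
  move=> lend; rewrite /binomial_transform.
  rewrite (sum_ord_widen _ (fun j => 'C(n, j)%:R * z ^+ (n - j) * g j) _ d.+1) //.
    by apply: eq_bigr => j _; rewrite coef_linear_exp expr1n mulr1.
  by move=> i ltni; rewrite bin_small // !mul0r.
have expand (p q : {poly R}) (k : nat) : (k <= d)%N ->
    p ^+ (d - k) * (p + q) ^+ k =
    \sum_(i < d.+1) 'C(k, i)%:R * q ^+ i * p ^+ (d - i).
  move=> lekd; rewrite exprDn mulr_sumr.
  pose f i := p ^+ (d - k) * (p ^+ (k - i) * q ^+ i *+ 'C(k, i)).
  rewrite (sum_ord_widen _ f _ d.+1) //; last first.
    by move=> i ltki; rewrite /f bin_small // mulr0n mulr0.
  apply: eq_bigr => i _; rewrite /f; case: (leqP i k) => [leik|ltki]; last first.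
    by rewrite bin_small // mulr0n mulr0 !mul0r.
  have -> : (d - i = (d - k) + (k - i))%N by lia.
  by rewrite exprD -mulr_natl; ring.
have Lsum (F : 'I_d.+1 -> {poly R}) : L (\sum_i F i) = \sum_i L (F i).
  exact: (big_morph L LD L0).
have el := expand (z%:P + 1%:P * 'X) (- z%:P) m lemd.
have er := expand 'X z%:P (d - m)%N (leq_subr _ _).
have natP k i : ('C(k, i))%:R = ('C(k, i)%:R)%:P :> {poly R} by rewrite polyC_natr.
transitivity (L ('X^m * (z%:P + 1%:P * 'X) ^+ (d - m))).
  (* Writing ['X] as [('X + z) - z] expands the product in powers of ['X + z], which [L] sends to
     the binomial transform. *)
  have -> : 'X^m * (z%:P + 1%:P * 'X) ^+ (d - m) =
     \sum_(i < d.+1) ('C(m, i)%:R * (- z) ^+ i)%:P * (z%:P + 1%:P * 'X) ^+ (d - i).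
    rewrite mulrC -[X in _ * X ^+ m](_ : z%:P + 1%:P * 'X + - z%:P = 'X).
      rewrite el; apply: eq_bigr => i _.
      by rewrite natP polyCM polyC_exp polyCN.
    by rewrite mul1r addrC addKr.
  rewrite Lsum; apply: eq_bigr => i _.
  by rewrite LC Lexp // leq_subr.
rewrite subKn // in er.
have -> : 'X^m * (z%:P + 1%:P * 'X) ^+ (d - m) =
   \sum_(i < d.+1) ('C(d - m, i)%:R * z ^+ i)%:P * 'X^(d - i).
  rewrite mul1r [z%:P + _]addrC er; apply: eq_bigr => i _.
  by rewrite natP polyCM polyC_exp.
by rewrite Lsum; apply: eq_bigr => i _; rewrite LC LX // leq_subr.
Qed.

(** Summing [gcoef_duality] with weights in [- 2 y] undoes the transform, while the powers of [y]
    add up to [y^(d-m+1) (y - 2 y)^m]. *)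
Lemma gcoef_sum_duality x y (d m : nat) : x = 1 + y -> (m <= d)%N ->
  binomial_sum d (- (2 * y)) (fun j => x * gcoef x (- (x * y)) j) m =
  binomial_sum d (2 * y) (gcoef 1 y) (d - m) + (-1) ^+ m * y ^+ d.+1.
Proof.
move=> Ex lemd; rewrite -binomial_sum_transform // /binomial_sum.
have -> : (-1) ^+ m * y ^+ d.+1 =
    \sum_(i < d.+1) 'C(m, i)%:R * (- (2 * y)) ^+ i * y ^+ (d - i).+1.
  have -> : (-1) ^+ m * y ^+ d.+1 = y ^+ (d - m).+1 * (y + - (2 * y)) ^+ m.
    have -> : y + - (2 * y) = - y by ring.
    by rewrite (exprNn y) -[in LHS](subnK lemd) -addSn exprD mulrCA.
  pose f i := y ^+ (d - m).+1 * (y ^+ (m - i) * (- (2 * y)) ^+ i *+ 'C(m, i)).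
  rewrite exprDn mulr_sumr (sum_ord_widen _ f _ d.+1) //; last first.
    by move=> i ltmi; rewrite /f bin_small // mulr0n mulr0.
  apply: eq_bigr => i _; rewrite /f; case: (leqP i m) => [leim|ltmi]; last first.
    by rewrite bin_small // mulr0n mulr0 !mul0r.
  have -> : ((d - i).+1 = (d - m).+1 + (m - i))%N by lia.
  by rewrite exprD -mulr_natl; ring.
by rewrite -big_split; apply: eq_bigr => i _; rewrite gcoef_duality // mulrDr.
Qed.

End TruncatedSeries.

Arguments gcoef {R}.
Arguments binomial_sum {R}.

(** * Reversal of polynomials *)

Section PolynomialReversal.

Variable R : comNzRingType.
Implicit Types p q : {poly R}.

(** This is [x^n p(1/x)] for [p] of degree at most [n]; the formal degree is explicit because it may
    exceed the actual one. *)
Definition rev_poly (n : nat) p : {poly R} := \poly_(i < n.+1) p`_(n - i).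

Lemma coef_rev_poly n p i : (i <= n)%N -> (rev_poly n p)`_i = p`_(n - i).
Proof. by move=> lein; rewrite coef_poly ltnS lein. Qed.

Lemma rev_polyD n : {morph rev_poly n : p q / p + q}.
Proof.
move=> p q; apply/polyP => i; rewrite coefD !coef_poly.
by case: ifP; rewrite ?coefD ?addr0.
Qed.

Lemma rev_polyCM n (c : R) p : rev_poly n (c%:P * p) = c%:P * rev_poly n p.
Proof.
apply/polyP => i; rewrite coefCM !coef_poly.
by case: ifP; rewrite ?coefCM ?mulr0.
Qed.

Lemma rev_poly_sum n (I : Type) (r : seq I) (F : I -> {poly R}) :
  rev_poly n (\sum_(i <- r) F i) = \sum_(i <- r) rev_poly n (F i).
Proof.
apply: (big_morph _ (rev_polyD n)).
by apply/polyP => i; rewrite coef_poly !coef0; case: ifP.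
Qed.

Lemma rev_poly_XsubC_exp n i : (i <= n)%N ->
  rev_poly n (('X - 1) ^+ i) = (- ('X - 1)) ^+ i * 'X^(n - i).
Proof.
elim: n i => [|n IHn] [|i] // lein; apply/polyP => j.
- by rewrite !expr0 mulr1 coef_poly !coef1; case: j.
- rewrite !expr0 mul1r subn0 coef_poly coef1 coefXn subn_eq0.
  by rewrite eqn_leq ltnS; case: (j <= n.+1)%N.
rewrite (exprS (- _)) -mulrA subSS -IHn // exprS.
(* This coefficient appears at [j = 0], beyond the range of the reversal of degree [n]. *)
have sz : (('X - 1) ^+ i : {poly R})`_n.+1 = 0.
  by rewrite nth_default // size_exp_XsubC.
rewrite opprB !mulrBl !mul1r coefB coefXM !coef_poly coefB coefXM.
case: j => [|j].
  by rewrite !subn0 /= sz !subr0.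
rewrite ltnS /= subSS ltnS; case: (ltngtP j n) => [ltjn|ltnj|->].
- by rewrite subn_eq0 leqNgt ltjn ltnS ltjn /= -subnS.
- by rewrite ltnS ltnNge (ltnW ltnj) subrr.
by rewrite subnn ltnn.
Qed.

End PolynomialReversal.

Arguments rev_poly {R}.

(** * The polynomials [gL] and [Q] and their symmetry *)

(** For [m <= n] both sides equal [(2n)! / (n! m! (n-m)!)]. *)
Lemma bin_central_mul (n m : nat) :
  ('C(2 * n, n) * 'C(n, m) = 'C(n + m, m) * 'C(2 * n, n + m))%N.
Proof.
case: (leqP m n) => [lemn|ltnm]; last first.
  by rewrite (bin_small ltnm) (@bin_small (2 * n) (n + m)) ?muln0 //; lia.
have f1 := @bin_fact (2 * n) n; have f2 := bin_fact lemn.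
have f3 := @bin_fact (n + m) m; have f4 := @bin_fact (2 * n) (n + m).
rewrite (_ : 2 * n - n = n)%N in f1; last lia.
rewrite (_ : n + m - m = n)%N in f3; last lia.
rewrite (_ : 2 * n - (n + m) = n - m)%N in f4; last lia.
apply/eqP; rewrite -(@eqn_pmul2r (n`! * m`! * (n - m)`!)) ?muln_gt0 ?fact_gt0 //.
apply/eqP; transitivity (2 * n)`!%N.
  by rewrite -f1 -?f2; [ring|lia].
by rewrite -f4 -?f3; [ring|lia|lia].
Qed.

Lemma gL_gcoef (j : nat) : gL j = gcoef 1 ('X - 1) j.
Proof.
rewrite /gL /gcoef big_mkord.
rewrite (sum_ord_widen _ (fun m => ((j - m + 1)%:R^-1 * 'C(j, m)%:R
    * 'C(2 * j - 2 * m, j)%:R) *: ('X - 1) ^+ m) _ j.+1) //; last first.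
- move=> m lem; case: (ltnP j m) => [ltjm|lemj].
    by rewrite (bin_small ltjm) mulr0 mul0r scale0r.
  rewrite (@bin_small (2 * j - 2 * m)) ?mulr0 ?scale0r //.
  by move: lem lemj (odd_double_half j); rewrite -mul2n; lia.
- by rewrite ltn_half_double -addnn leq_addr.
apply: eq_bigr => m _; have lemj : (m <= j)%N by rewrite -ltnS.
rewrite expr1n mul1r -mul_polyC -(polyC_natr _ _); congr (_%:P * _).
rewrite -mulrA -natrM -mulnBr.
have -> : ('C(j, m) * 'C(2 * (j - m), j) = 'C(2 * (j - m), j - m) * 'C(j - m, m))%N.
  by rewrite bin_central_mul subnK.
rewrite -mul_catalan -mulnA natrM addn1 mulKf // Num.Theory.pnatr_eq0 //.
Qed.

Lemma rev_poly_gL (d i : nat) : (i <= d)%N ->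
  rev_poly d.+1 (('X - 1) ^+ i * gL (d - i)) =
  (- ('X - 1)) ^+ i * ('X * gcoef 'X (- ('X * ('X - 1))) (d - i)).
Proof.
move=> leid; rewrite gL_gcoef /gcoef !mulr_sumr rev_poly_sum; apply: eq_bigr => m _.
rewrite expr1n mul1r mulrCA -exprD -(polyC_natr _ (_ * _)) rev_polyCM polyC_natr.
(* When [2 m > d - i] the truncated exponent is harmless, as the binomial coefficient vanishes. *)
case: (leqP m (d - i - m)) => [lem|ltm]; last by rewrite bin_small // muln0; ring.
rewrite rev_poly_XsubC_exp; last by lia.
have -> : (d.+1 - (i + m) = (d - i - m - m) + m + 1)%N by lia.
rewrite !exprD -mulrN [(_ * - _) ^+ m]exprMn expr1; ring.
Qed.

(** Common building block of all [Q d k]: one [Qsum] at [k = d + 1], one plus [('X - 1)^(d+1)] at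
    [k = 0], and two with consecutive [m] otherwise. *)
Definition Qsum (d m : nat) : {poly rat} := binomial_sum d (2 * ('X - 1)) gL m.

Lemma rev_poly_Qsum (d m : nat) : (m <= d)%N ->
  rev_poly d.+1 (Qsum d m) =
  Qsum d (d - m) + (-1) ^+ m * ('X - 1) ^+ d.+1.
Proof.
move=> lemd.
have Ex : 'X = 1 + ('X - 1) :> {poly rat} by rewrite addrC subrK.
have gE k : Qsum d k = binomial_sum d (2 * ('X - 1)) (gcoef 1 ('X - 1)) k.
  by apply: eq_bigr => i _; rewrite gL_gcoef.
rewrite [in RHS]gE -(gcoef_sum_duality _ 'X) // /Qsum /binomial_sum rev_poly_sum.
apply: eq_bigr => i _; have leid : (i <= d)%N by rewrite -ltnS.
have -> : 'C(m, i)%:R * (2 * ('X - 1)) ^+ i * gL (d - i) =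
    ('C(m, i)%:R * 2 ^+ i)%:P * (('X - 1) ^+ i * gL (d - i)).
  by rewrite polyCM polyC_natr polyC_exp polyC_natr exprMn; ring.
rewrite rev_polyCM rev_poly_gL // -[- (2 * _)]mulrN exprMn.
by rewrite polyCM polyC_natr polyC_exp polyC_natr; ring.
Qed.

Lemma Q_Qsum (d k : nat) : (1 <= k <= d)%N ->
  Q d k = Qsum d (d - k) + Qsum d (d + 1 - k).
Proof.
case/andP=> k_gt0 lekd; rewrite /Q eqn0Ngt k_gt0 lekd /=.
rewrite /Qsum /binomial_sum -big_split /= -(big_mkord predT (fun i =>
  'C(d - k, i)%:R * (2 * ('X - 1)) ^+ i * gL (d - i) +
  'C(d + 1 - k, i)%:R * (2 * ('X - 1)) ^+ i * gL (d - i))).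
rewrite [RHS]big_nat_rev /= add0n (@big_cat_nat _ _ _ (k - 1) 0 d.+1) //=; last lia.
(* For [j < k - 1] one has [d - j > d + 1 - k], so both binomials vanish. *)
rewrite [X in _ = X + _]big1_seq ?add0r => [|j]; last first.
  rewrite mem_index_iota => /andP[_ ltj].
  by rewrite !bin_small ?mul0r ?addr0 //; lia.
apply: eq_big_nat => j /andP[_ ltj]; rewrite subSS subKn //.
rewrite -mul_polyC polyCM polyCD !polyC_natr polyC_exp polyC_natr exprMn; ring.
Qed.

Lemma Q0_Qsum (d : nat) : Q d 0 = ('X - 1) ^+ d.+1 + Qsum d d.
Proof.
rewrite /Q /= addn1 /Qsum /binomial_sum big_mkord (reindex_inj rev_ord_inj) /=.
congr (_ + _); apply: eq_bigr => i _; have leid : (i <= d)%N by rewrite -ltnS.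
rewrite subSS subKn // bin_sub // -mul_polyC polyCM polyC_natr polyC_exp.
by rewrite polyC_natr exprMn; ring.
Qed.

Lemma Qmax_Qsum (d : nat) : Q d d.+1 = Qsum d 0.
Proof.
rewrite /Q /= ltnn /Qsum /binomial_sum big_ord_recl /= bin0 subn0 mul1r mul1r.
by rewrite big1 ?addr0 // => i _; rewrite bin_small // !mul0r.
Qed.

(** The corrections [(-1)^m ('X - 1)^(d+1)] for consecutive [m] cancel; at [k = 0] and [k = d + 1]
    the correction accounts for the extra term of [Q d 0]. *)
Lemma rev_poly_Q (d k : nat) : (k <= d + 1)%N ->
  rev_poly d.+1 (Q d k) = Q d (d + 1 - k).
Proof.
rewrite addn1 => lek; case: k lek => [|k] lek.
  rewrite subn0 Q0_Qsum Qmax_Qsum rev_polyD rev_poly_Qsum // subnn.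
  by rewrite rev_poly_XsubC_exp // subnn (exprNn ('X - 1)) (exprS (-1)); ring.
case: (ltngtP k d) lek => [ltkd _|ltdk|-> _]; last 2 first.
- by rewrite ltnS leqNgt ltdk.
- by rewrite subnn Q0_Qsum Qmax_Qsum rev_poly_Qsum // subn0; ring.
rewrite !Q_Qsum ?rev_polyD; try lia.
rewrite !rev_poly_Qsum; try lia.
rewrite (_ : d - (d - k.+1) = k.+1)%N; last lia.
rewrite (_ : d - (d + 1 - k.+1) = k)%N; last lia.
rewrite (_ : d - (d.+1 - k.+1) = k)%N; last lia.
rewrite (_ : d + 1 - (d.+1 - k.+1) = k.+1)%N; last lia.
rewrite (_ : d + 1 - k.+1 = (d - k.+1).+1)%N; last lia.
by rewrite (exprS (-1)); ring.
Qed.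

Theorem theorem5p5 (d k : nat) (hd : (1 <= d)%N) (hk : (k <= d + 1)%N) :
  forall l : nat, (l <= d + 1)%N ->
    (Q d k)`_l = (Q d (d + 1 - k))`_(d + 1 - l).
Proof.
move=> l; rewrite -rev_poly_Q // addn1 => lel.
by rewrite coef_rev_poly ?leq_subr // subKn.
Qed.
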